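(* Let $\gamma>1$, $\varepsilon\in(0,1]$, $\eta>0$, let $(\mathcal M,\mathcal E)$ be a MAC grid of $\Omega$ and let $\delta t>0$. Let $(\rho^n,\boldsymbol u^n,\theta^n)\in L_{\mathcal M}(\Omega)\times \boldsymbol H_{\mathcal E,0}(\Omega)\times L_{\mathcal M}(\Omega)$ be such that $\rho^n>0$ and $\theta^n>0$ on $\Omega$. Assume the time-step condition $$\frac{\delta t}{|K|}\sum_{\sigma\in\mathcal E(K)}\frac{|F_{\sigma,K}(\rho^n,\boldsymbol u^n)|}{\rho^n_K}\le \frac13\qquad\text{for all }K\in\mathcal M .$$ Then there exists a solution $(\rho^{n+1},\boldsymbol u^{n+1},\theta^{n+1})\in L_{\mathcal M}(\Omega)\times \boldsymbol H_{\mathcal E,0}(\Omega)\times L_{\mathcal M}(\Omega)$ of the scheme $$\frac{1}{\delta t}(\rho_K^{n+1}-\rho_K^n)+\frac1{|K|}\sum_{\sigma\in\mathcal E(K)}F_{\sigma,K}(\rho^n,\boldsymbol u^n)=0,\quad \forall K\in\mathcal M,$$ $$\frac1{\delta t}(\rho^{n+1}_{D_\sigma}u^{n+1}_\sigma-\rho^n_{D_\sigma}u^n_\sigma)+\frac1{|D_\sigma|}\sum_{\epsilon\in\tilde{\mathcal E}(D_\sigma)}F_{\epsilon,\sigma}(\rho^n,\boldsymbol u^n)u^n_{\epsilon,\mathrm{up}}+\frac1{\varepsilon^2}(\partial^{(i)}_{\mathcal E}p^{n+1})_\sigma=0,\quad 1\le i\le d,\ \forall\sigma\in\mathcal E^{(i)}_{\mathrm{int}},$$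 $$\frac1{\delta t}(\rho^{n+1}_K\theta^{n+1}_K-\rho^n_K\theta^n_K)+\frac1{|K|}\sum_{\sigma\in\mathcal E(K)}F_{\sigma,K}(\rho^{n+1}\theta^{n+1},\boldsymbol v^{n+1})=0,\quad\forall K\in\mathcal M,$$ where $p^{n+1}_K=(\rho_K^{n+1}\theta_K^{n+1})^\gamma$, and this solution satisfies $\rho^{n+1}>0$ and $\theta^{n+1}>0$ on $\Omega$.
   Context: Grid. $\Omega$ is a $d$-dimensional box, $d\in\{1,2,3\}$, with periodic boundary conditions (i.e. identified with the torus $\mathbb T^d$). A MAC grid $(\mathcal M,\mathcal E)$ consists of a primal mesh $\mathcal M$: a conforming, structured, possibly non-uniform partition of $\bar\Omega$ into closed axis-parallel boxes $K$ (primal cells), and the set $\mathcal E$ of their faces $\sigma$. $\mathcal E^{(i)}$ is the set of faces orthogonal to the $i$-th unit vector $\boldsymbol e^{(i)}$; $\mathcal E(K)$ is the set of faces of $K$. Because of periodicity every face is internal, $\mathcal E_{\mathrm{int}}=\mathcal E$, $\mathcal E^{(i)}_{\mathrm{int}}=\mathcal E^{(i)}$, and each face is $\sigma=K|L$, the common face of two cells $K\ne L$. $|K|$ and $|\sigma|$ denote $d$- and $(d-1)$-dimensional measures ($|\sigma|=1$ if $d=1$). The dual cell $D_\sigma$ of $\sigma=K|L$ is the union of the halves of $K$ and $L$ adjacent to $\sigma$, so $|D_\sigma|=\frac12(|K|+|L|)$; $\tilde{\mathcal E}(D_\sigma)$ is the set of faces $\epsilon$ of $D_\sigma$, and $\epsilon=D_\sigma|D_{\sigma'}$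 is the face shared by the dual cells of $\sigma,\sigma'\in\mathcal E^{(i)}$. Discrete spaces. $L_{\mathcal M}(\Omega)$: real functions constant on each $K\in\mathcal M$ (value $q_K$). $\boldsymbol H_{\mathcal E}(\Omega)$: vector fields whose $i$-th component is constant on each $D_\sigma$, $\sigma\in\mathcal E^{(i)}$ (value $u_\sigma$), $1\le i\le d$. $\boldsymbol H_{\mathcal E,0}(\Omega)$ is the subspace vanishing on external faces; here there are none, so it equals $\boldsymbol H_{\mathcal E}(\Omega)$. Notation. $a^+=\max\{a,0\}$, $a^-=\min\{a,0\}$. $\boldsymbol\nu_{\sigma,K}$ is the unit normal to $\sigma$ outward to $K$, and $u_{\sigma,K}=u_\sigma\,\boldsymbol e^{(i)}\cdot\boldsymbol\nu_{\sigma,K}$ for $\sigma\in\mathcal E^{(i)}\cap\mathcal E(K)$. For $\sigma=K|L\in\mathcal E^{(i)}$, $(\partial^{(i)}_{\mathcal E}q)_\sigma=\frac{|\sigma|}{|D_\sigma|}(q_L-q_K)\,\boldsymbol e^{(i)}\cdot\boldsymbol\nu_{\sigma,K}$. Mass flux ($\sigma=K|L$): $F_{\sigma,K}(\rho,\boldsymbol u)=|\sigma|\{\rho_K u_{\sigma,K}^++\rho_L u_{\sigma,K}^-\}$. Dual density: $|D_\sigma|\rho_{D_\sigma}=\frac12|K|\rho_K+\frac12|L|\rho_L$. Dual mass fluxes, for $\sigma=K|L\in\mathcal E^{(i)}$, with $F_{\sigma,K}=F_{\sigma,K}(\rho,\boldsymbol u)$: if $\epsilon\subset K$ is orthogonal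 to $\boldsymbol e^{(i)}$ and $\sigma'$ is the face of $K$ opposite to $\sigma$, $F_{\epsilon,\sigma}=\frac12(F_{\sigma',K}-F_{\sigma,K})$ (similarly in $L$); if $\epsilon$ is not orthogonal to $\boldsymbol e^{(i)}$, it is the union of a half of a face $\tau\in\mathcal E(K)$ and a half of a face $\tau'\in\mathcal E(L)$, and $F_{\epsilon,\sigma}=\frac12(F_{\tau,K}+F_{\tau',L})$. Upwind value: for $\epsilon=D_\sigma|D_{\sigma'}$, $u_{\epsilon,\mathrm{up}}=u_\sigma$ if $F_{\epsilon,\sigma}\ge0$ and $u_{\epsilon,\mathrm{up}}=u_{\sigma'}$ otherwise. Stabilised velocity and temperature flux: $v^{n+1}_\sigma=u^n_\sigma-\delta u^{n+1}_\sigma$ with $\delta u_\sigma^{n+1}=\frac{\eta\,\delta t}{\varepsilon^2}(\partial_{\mathcal E}^{(i)}p^{n+1})_\sigma$ for $\sigma\in\mathcal E^{(i)}_{\mathrm{int}}$; with $\delta u_{\sigma,K}=\delta u_\sigma\boldsymbol e^{(i)}\cdot\boldsymbol\nu_{\sigma,K}$, set $(v^{n+1}_{\sigma,K})_+=(u^n_{\sigma,K})^+-(\delta u^{n+1}_{\sigma,K})^-$ and $(v^{n+1}_{\sigma,K})_-=(u^n_{\sigma,K})^--(\delta u^{n+1}_{\sigma,K})^+$; then, for $\sigma=K|L$, $$F_{\sigma,K}(\rho^{n+1}\theta^{n+1},\boldsymbol v^{n+1})=|\sigma|\{\rho^{n+1}_K\theta^{n+1}_K(v^{n+1}_{\sigma,K})_++\rho^{n+1}_L\theta^{n+1}_L(v^{n+1}_{\sigma,K})_-\}.$$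 *)

(* Defs.v *)
From HB Require Import structures.
From mathcomp Require Import all_boot all_order all_algebra.
From mathcomp Require Import reals exp.

Set Implicit Arguments.
Unset Strict Implicit.
Unset Printing Implicit Defensive.

Import Order.TTheory GRing.Theory Num.Theory.
Local Open Scope ring_scope.

(* A structured, possibly non-uniform partition of the periodic box
   prod_i [a i, b i]: in direction i there are [ncells i] intervals
   [node i k, node i k.+1], k < ncells i. Values [node i k] with
   k > ncells i play no role. At least two intervals per direction are
   required so that, on the torus, a face always separates two distinct
   cells. *)
Record mac_grid (R : realType) (d : nat) (a b : 'I_d -> R) := MacGrid {
  ncells : 'I_d -> nat;
  node : 'I_d -> nat -> R;
  ncells_gt1 : forall i, (1 < ncells i)%N;
  node_first : forall i, node i 0 = a i;
  node_last : forall i, node i (ncells i) = b i;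
  node_lt : forall i k, (k < ncells i)%N -> node i k < node i k.+1
}.

Section Grid.
Context {R : realType} {d : nat} {a b : 'I_d -> R}.
Variable G : mac_grid a b.

(* The multi-index K stands for the closed box
   prod_i [node i (K i), node i (K i).+1]. *)
Definition cell : finType := {dffun forall i : 'I_d, 'I_(ncells G i)}.

(* Periodic neighbours in direction e^(i); [ordS] and [ord_pred] are cyclic. *)
Definition cell_next (i : 'I_d) (K : cell) : cell :=
  finfun (dfwith K (ordS (K i))).

(* (i, K) is the face orthogonal to e^(i) through which one leaves K in the
   direction +e^(i). On the torus each face has exactly one such name. *)
Definition face : finType := ('I_d * cell)%type.

Definition dir (s : face) : 'I_d := s.1.
Definition lower (s : face) : cell := s.2.
Definition upper (s : face) : cell := cell_next s.1 s.2.

Definition faces (K : cell) : {set face} :=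
  [set s | (lower s == K) || (upper s == K)].

(* The L such that s = K|L. *)
Definition across (s : face) (K : cell) : cell :=
  if K == lower s then upper s else lower s.

(* e^(i) . nu_{s,K}, for i = dir s and K one of the two cells adjacent to s. *)
Definition normal (s : face) (K : cell) : R :=
  if K == lower s then 1 else -1.

Definition step (i : 'I_d) (K : cell) : R :=
  node G i (K i).+1 - node G i (K i).

Definition cell_meas (K : cell) : R := \prod_i step i K.

(* The empty product gives measure 1 when d = 1. *)
Definition face_meas (s : face) : R :=
  \prod_(j | j != dir s) step j (lower s).

Definition dual_meas (s : face) : R :=
  2^-1 * (cell_meas (lower s) + cell_meas (upper s)).

(* Faces of the dual cells D_s: (j, s) is the face orthogonal to e^(j) through
   which one leaves D_s in the direction +e^(j). It is shared by D_s and the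
   dual cell of s translated by one cell in the direction j. *)
Definition dual_face : finType := ('I_d * face)%type.

Definition dual_lower (e : dual_face) : face := e.2.
Definition dual_upper (e : dual_face) : face :=
  (dir e.2, cell_next e.1 (lower e.2)).

Definition dual_faces (s : face) : {set dual_face} :=
  [set e | (dual_lower e == s) || (dual_upper e == s)].

(* The s' such that e = D_s|D_s'. *)
Definition dual_across (e : dual_face) (s : face) : face :=
  if s == dual_lower e then dual_upper e else dual_lower e.

(* Discrete functions are given by their values on the cells of the primal
   mesh (L_M) and of the dual meshes (H_E); there is no external face. *)
Definition L_M := {ffun cell -> R}.
Definition H_E := {ffun face -> R}.

Definition pos (x : R) : R := Num.max x 0.
Definition neg (x : R) : R := Num.min x 0.

(* u_{s,K} *)
Definition outward (u : H_E) (s : face) (K : cell) : R := u s * normal s K.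

(* (partial_E^(i) q)_s, i = dir s; the formula does not depend on which of the
   two cells adjacent to s is called K. *)
Definition dgrad (q : L_M) : H_E :=
  [ffun s => let K := lower s in let L := across s K in
     face_meas s / dual_meas s * (q L - q K) * normal s K].

Definition mass_flux (rho : L_M) (u : H_E) (s : face) (K : cell) : R :=
  face_meas s * (rho K * pos (outward u s K)
                 + rho (across s K) * neg (outward u s K)).

Definition dual_density (rho : L_M) (s : face) : R :=
  (2^-1 * cell_meas (lower s) * rho (lower s)
   + 2^-1 * cell_meas (upper s) * rho (upper s)) / dual_meas s.

(* F_{e,s}, for s = K|L of direction i and e a face of D_s.
   - e orthogonal to e^(i): e = D_s|D_s' lies in the cell C (one of K, L)
     between its opposite faces s and s', which is [upper (dual_lower e)].
   - e orthogonal to e^(j), j != i: e is made of half of a face tau of K and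
     half of a face tau' of L, both orthogonal to e^(j). Those are the faces
     (j, _) attached to the two cells adjacent to [dual_lower e], whichever
     of the two sides of e the dual cell D_s is on. *)
Definition dual_flux (rho : L_M) (u : H_E) (e : dual_face) (s : face) : R :=
  if e.1 == dir s then
    let C := upper (dual_lower e) in
    let s' := dual_across e s in
    2^-1 * (mass_flux rho u s' C - mass_flux rho u s C)
  else
    let tau : face := (e.1, lower (dual_lower e)) in
    let tau' : face := (e.1, upper (dual_lower e)) in
    2^-1 * (mass_flux rho u tau (lower s) + mass_flux rho u tau' (upper s)).

(* u_{e,up}, seen from s: e = D_s|D_s'. *)
Definition upwind (rho : L_M) (u : H_E) (e : dual_face) (s : face) : R :=
  if 0 <= dual_flux rho u e s then u s else u (dual_across e s).

Definition pressure (gamma : R) (rho theta : L_M) : L_M :=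
  [ffun K => (rho K * theta K) `^ gamma].

(* delta u^{n+1}, from p = p^{n+1} *)
Definition vel_corr (eta dt eps : R) (p : L_M) : H_E :=
  [ffun s => eta * dt / eps ^+ 2 * dgrad p s].

(* v^{n+1}, from u = u^n and du = delta u^{n+1}, and its splitting; the two
   parts are in general not the positive and negative parts of v_{s,K}. *)
Definition stab_vel (u du : H_E) : H_E := [ffun s => u s - du s].

Definition stab_plus (u du : H_E) (s : face) (K : cell) : R :=
  pos (outward u s K) - neg (outward du s K).

Definition stab_minus (u du : H_E) (s : face) (K : cell) : R :=
  neg (outward u s K) - pos (outward du s K).

Lemma stab_split u du s K :
  stab_plus u du s K + stab_minus u du s K = outward (stab_vel u du) s K.
Proof.
rewrite /stab_plus /stab_minus addrACA -opprD [neg _ + pos _]addrC.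
by rewrite /pos /neg !addr_max_min !addr0 /outward ffunE mulrBl.
Qed.

Definition temp_flux (rho theta : L_M) (u du : H_E) (s : face) (K : cell) : R :=
  face_meas s * (rho K * theta K * stab_plus u du s K
     + rho (across s K) * theta (across s K) * stab_minus u du s K).

(* One time step from (rho, u, theta) to (rho', u', theta'). *)
Definition mass_balance (dt : R) (rho : L_M) (u : H_E) (rho' : L_M) : Prop :=
  forall K : cell,
    dt^-1 * (rho' K - rho K)
    + (cell_meas K)^-1 * (\sum_(s in faces K) mass_flux rho u s K) = 0.

Definition momentum_balance (gamma eps dt : R) (rho : L_M) (u : H_E)
    (rho' : L_M) (u' : H_E) (theta' : L_M) : Prop :=
  forall s : face,
    dt^-1 * (dual_density rho' s * u' s - dual_density rho s * u s)
    + (dual_meas s)^-1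
      * (\sum_(e in dual_faces s) dual_flux rho u e s * upwind rho u e s)
    + (eps ^+ 2)^-1 * dgrad (pressure gamma rho' theta') s = 0.

Definition temp_balance (gamma eps eta dt : R) (rho : L_M) (u : H_E)
    (theta rho' theta' : L_M) : Prop :=
  let du := vel_corr eta dt eps (pressure gamma rho' theta') in
  forall K : cell,
    dt^-1 * (rho' K * theta' K - rho K * theta K)
    + (cell_meas K)^-1
      * (\sum_(s in faces K) temp_flux rho' theta' u du s K) = 0.

End Grid.

(* Main.v *)
Require Import Defs.
From HB Require Import structures.
From mathcomp Require Import all_boot all_order all_algebra.
From mathcomp Require Import boolp classical_sets reals topology normedtype exp.
From mathcomp Require Import function_spaces sequences ring lra zify.

Set Implicit Arguments.
Unset Strict Implicit.
Unset Printing Implicit Defensive.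

Import Order.TTheory GRing.Theory Num.Theory.
Import numFieldNormedType.Exports.
Local Open Scope ring_scope.

(** The mass balance is explicit, and so is the momentum balance once the
    pressure is known. What is left is the temperature balance, an implicit
    system for [w = rho' * theta'] alone. The stabilised flux leaving [K]
    through [K|L] is nonincreasing in [w L], so the pointwise supremum [w] of
    all nonnegative subsolutions is again a subsolution. If its inequality were
    strict at [K], then [w K] could be raised a little, which only helps the
    other cells; so [w] is a solution. The supremum is finite because the fluxes
    cancel in pairs, which bounds the mass of a subsolution by that of the data. *)

(** * Perron's method for a finite monotone system *)

Section Perron.
Context {R : realType} {T : finType}.
(** In [h K x w] the unknown [x] at [K] is separated from the neighbouring values [w]: monotonicity
    is required in [w] only, continuity in [x] only. *)
Variables (m f : T -> R) (h : T -> R -> (T -> R) -> R).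
Hypothesis m_gt0 : forall K, 0 < m K.
Hypothesis f_gt0 : forall K, 0 < f K.
Hypothesis h_anti : forall K x (w w' : T -> R), 0 <= x ->
  (forall L, 0 <= w L <= w' L) -> h K x w' <= h K x w.
Hypothesis h_cont : forall K w, continuous (fun x => h K x w).
Hypothesis h_mass : forall w : T -> R, (forall K, 0 <= w K) ->
  \sum_K m K * w K <= \sum_K m K * h K (w K) w.
Hypothesis h_le0 : forall K, h K 0 (fun=> 0) <= 0.

Let subsol (w : T -> R) := forall K, 0 <= w K /\ h K (w K) w <= f K.

Let values K : set R := fun x => exists2 w, subsol w & x = w K.

Let wsup K : R := sup (values K).

(** The term [m K * w K] is at most the total mass of [w], which [h_mass] and the subsolution
    inequalities bound by the mass of [f]. *)
Let subsol_le w K : subsol w -> w K <= (\sum_L m L * f L) / m K.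
Proof.
move=> sw; rewrite ler_pdivlMr // mulrC.
have w0 L : 0 <= w L by case: (sw L).
apply: (@le_trans _ _ (\sum_L m L * w L)).
  rewrite (bigD1 K) //= lerDl sumr_ge0 // => L _.
  by rewrite mulr_ge0 // ltW.
apply: le_trans (h_mass w0) _.
by apply: ler_sum => L _; rewrite ler_pM2l //; case: (sw L).
Qed.

Let subsol0 : subsol (fun=> 0).
Proof. by move=> K; split=> //; exact: le_trans (h_le0 K) (ltW (f_gt0 K)). Qed.

Let has_sup_values K : has_sup (values K).
Proof.
split; first by exists 0; exists (fun=> 0).
by exists ((\sum_L m L * f L) / m K) => _ [w sw ->]; exact: subsol_le.
Qed.

Let le_wsup w K : subsol w -> w K <= wsup K.
Proof. by move=> sw; apply: sup_upper_bound => //; exists w. Qed.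

Let wsup_ge0 K : 0 <= wsup K.
Proof. exact: (le_wsup K subsol0). Qed.

(** A strict inequality at [x], in either direction, survives within some radius. One direction
    serves to descend from the supremum, the other to rise above it. *)
Let h_nbhs K x w : exists2 e, 0 < e & forall y, `|x - y| < e ->
  (f K < h K x w -> f K < h K y w) /\ (h K x w < f K -> h K y w < f K).
Proof.
case: (ltgtP (h K x w) (f K)) => [hf|hf|_]; last by exists 1.
- have : nbhs x (fun y => h K y w < f K)
    by exact: (cvgr_lt _ (@h_cont K w x) _ hf).
  case/nbhs_ballP => e e0 He.
  by exists e => // y xy; split=> // _; exact: He.
- have : nbhs x (fun y => f K < h K y w)
    by exact: (cvgr_gt _ (@h_cont K w x) _ hf).
  case/nbhs_ballP => e e0 He.
  by exists e => // y xy; split=> // _; exact: He.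
Qed.

(** A subsolution [w] close to the supremum at the single index [K] suffices. A strict excess at
    [wsup K] would persist at [w K], yet replacing [w] by the larger [wsup] in the last argument
    only lowers [h]. *)
Let subsol_wsup : subsol wsup.
Proof.
move=> K; split; first exact: wsup_ge0.
rewrite leNgt; apply/negP => hf.
have [e e0 He] := h_nbhs K (wsup K) wsup.
have [_ [w sw ->] wK] := sup_adherent e0 (has_sup_values K).
have [wge0 hw] := sw K.
have close : `|wsup K - w K| < e.
  by rewrite ger0_norm ?subr_ge0 ?le_wsup // ltrBlDl -ltrBlDr.
have := (He _ close).1 hf; apply/negP; rewrite -leNgt.
apply: le_trans hw; apply: h_anti => // L.
by rewrite le_wsup // andbT; case: (sw L).
Qed.

Lemma perron_solution : exists w : T -> R,
  forall K, 0 < w K /\ h K (w K) w = f K.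
Proof.
have sol K : h K (wsup K) wsup = f K.
  apply/eqP; rewrite eq_le (subsol_wsup K).2 leNgt; apply/negP => hf.
  have [e e0 He] := h_nbhs K (wsup K) wsup.
  have e20 : 0 < e / 2 by rewrite divr_gt0.
  pose w L := if L == K then wsup K + e / 2 else wsup L.
  have w_ge L : wsup L <= w L.
    by rewrite /w; case: eqP => // ->; rewrite lerDl ltW.
  have sw : subsol w.
    move=> L; split; first exact: le_trans (wsup_ge0 L) (w_ge L).
    rewrite {1}/w; case: eqP => [->|_].
      (* The raise also enters through the last argument, where it only lowers [h]; the raise of [x]
         by [e / 2] stays within the radius [e] of continuity. *)
      apply: le_trans (_ : h K (wsup K + e / 2) wsup <= _).
        by apply: h_anti => [|M]; rewrite ?addr_ge0 ?(ltW e20) ?wsup_ge0 ?w_ge.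
      apply/ltW/(He _ _).2 => //.
      rewrite opprD addrA subrr sub0r normrN gtr0_norm //.
      by rewrite ltr_pdivrMr // mulr_natr mulr2n ltrDl.
    apply: le_trans (subsol_wsup L).2.
    by apply: h_anti => // M; rewrite wsup_ge0 w_ge.
  by have := le_wsup K sw; rewrite /w eqxx gerDl leNgt e20.
(* If [wsup K] were 0, then [f K] would equal [h K 0 wsup], which is at most [h K 0 (fun=> 0)],
   hence at most 0. *)
exists wsup => K; split=> //; rewrite lt_neqAle wsup_ge0 andbT eq_sym.
apply/eqP => w0; have := f_gt0 K; rewrite -sol w0 ltNge => /negP; apply.
by apply: le_trans (h_le0 K); apply: h_anti => // L; rewrite lexx wsup_ge0.
Qed.

End Perron.

(** * The stabilised flux as a function of two real unknowns *)

Section Flux.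
Context {R : realType}.
Implicit Types x y z o c g : R.

Lemma posE x : pos x = (x + `|x|) / 2.
Proof. by rewrite /pos; case: ler0P => ?; field. Qed.

Lemma negE x : neg x = (x - `|x|) / 2.
Proof. by rewrite /neg; case: ler0P => ?; field. Qed.

Lemma pos_ge0 x : 0 <= pos x.
Proof. by rewrite /pos le_max lexx orbT. Qed.

Lemma neg_le0 x : neg x <= 0.
Proof. by rewrite /neg ge_min lexx orbT. Qed.

Lemma pos_mono x y : x <= y -> pos x <= pos y.
Proof. by move=> xy; rewrite /pos ge_max !le_max xy lexx orbT. Qed.

Lemma neg_mono x y : x <= y -> neg x <= neg y.
Proof. by move=> xy; rewrite /neg le_min !ge_min xy lexx orbT. Qed.

Lemma posN x : pos (- x) = - neg x.
Proof. by rewrite posE negE normrN; field. Qed.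

Lemma negN x : neg (- x) = - pos x.
Proof. by rewrite posE negE normrN; field. Qed.

Lemma continuous_pos : continuous (@pos R).
Proof.
move=> x; rewrite (_ : @pos R = fun x => (x + `|x|) / 2); last exact/funext/posE.
apply: cvgM; last exact: cvg_cst.
by apply: cvgD; [|apply: cvg_norm]; exact: cvg_id.
Qed.

Lemma continuous_neg : continuous (@neg R).
Proof.
move=> x; rewrite (_ : @neg R = fun x => (x - `|x|) / 2); last exact/funext/negE.
apply: cvgM; last exact: cvg_cst.
by apply: cvgB; [|apply: cvg_norm]; exact: cvg_id.
Qed.

(* The absolute value is needed: [x `^ g] is 1 for [x < 0], because [ln] vanishes
   there. *)
Lemma continuous_norm_powR g : 1 <= g -> continuous (fun x => `|x| `^ g).
Proof.
move=> g1 x; have g0 : 0 < g by exact: lt_le_trans g1.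
have cnorm : (`|y| @[y --> x] --> `|x|)%classic by apply: cvg_norm; exact: cvg_id.
have [->|x0] := eqVneq x 0.
  have cnorm0 : (`|y| @[y --> (0 : R)] --> (0 : R))%classic.
    rewrite -[X in (_ --> X)%classic](@normr0 R R).
    by apply: cvg_norm; exact: cvg_id.
  rewrite /continuous_at normr0 powR0 ?gt_eqF //.
  (* Within distance 1 of 0 the power lies between 0 and [|y|], because [1 <= g]. *)
  apply: (@squeeze_cvgr _ _ _ _ (fun=> 0) (fun y => `|y|)).
  - apply/nbhs_ballP; exists 1 => //= y; rewrite /ball/= sub0r normrN => /ltW y1.
    rewrite powR_ge0 /=; have [->|y0] := eqVneq y 0.
      by rewrite normr0 powR0 ?gt_eqF.
    by rewrite ge1r_powR // normr_gt0 y0.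
  - exact: cvg_cst.
  - exact: cnorm0.
have xn0 : 0 < `|x| by rewrite normr_gt0.
rewrite /continuous_at {2}/powR gt_eqF //.
apply: (@cvg_trans _ ((expR (g * ln `|y|)) @[y --> x]))%classic.
  have near_gt0 : nbhs x (fun y : R => 0 < `|y|).
    exact: (cvgr_gt _ cnorm _ xn0).
  apply: near_eq_cvg; apply: filterS near_gt0 => y y0.
  by rewrite /powR gt_eqF.
have cln : (ln `|y| @[y --> x] --> ln `|x|)%classic.
  exact: (cvg_comp _ _ cnorm (continuous_ln xn0)).
have cgln : (g * ln `|y| @[y --> x] --> g * ln `|x|)%classic.
  by apply: cvgM; first exact: cvg_cst.
exact: (cvg_comp _ _ cgln (@continuous_expR R _)).
Qed.

(** Flux per unit of face measure from a cell with value [x] of [rho * theta] to one with value [y].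
    Here [o] is the outward velocity, and [c] times the pressure jump is the outward velocity
    correction. *)
Definition stab_flux g c o x y : R :=
  x * (pos o - neg (c * (`|y| `^ g - `|x| `^ g)))
  + y * (neg o - pos (c * (`|y| `^ g - `|x| `^ g))).

(** Seen from the other cell, the velocity and the pressure jump change sign, which swaps the roles
    of [pos] and [neg]. This is the source of the cancellation in pairs. *)
Lemma stab_fluxN g c o x y : stab_flux g c (- o) y x = - stab_flux g c o x y.
Proof.
rewrite /stab_flux -(opprB (`|y| `^ g)) mulrN !posN !negN; ring.
Qed.

Lemma stab_flux0 g c o : stab_flux g c o 0 0 = 0.
Proof. by rewrite /stab_flux !mul0r addr0. Qed.

Lemma stab_flux_anti g c o x y z : 0 <= g -> 0 <= c -> 0 <= x -> 0 <= y <= z ->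
  stab_flux g c o x z <= stab_flux g c o x y.
Proof.
move=> g0 c0 x0 /andP[y0 yz]; have z0 := le_trans y0 yz.
have yzg : c * (`|y| `^ g - `|x| `^ g) <= c * (`|z| `^ g - `|x| `^ g).
  rewrite ler_wpM2l // lerB // !ger0_norm //.
  by apply: ge0_ler_powR; rewrite ?nnegrE.
rewrite /stab_flux lerD //; first by rewrite ler_wpM2l // lerB // neg_mono.
(* Pressure and transported value are changed separately: the pressure under the nonnegative factor
   [z], then the factor itself, whose coefficient is nonpositive. *)
apply: (@le_trans _ _ (z * (neg o - pos (c * (`|y| `^ g - `|x| `^ g))))).
  by rewrite ler_wpM2l // lerB // pos_mono.
by rewrite ler_wnM2r // subr_le0 (le_trans (neg_le0 _)) ?pos_ge0.
Qed.

Lemma continuous_stab_flux g c o y : 1 <= g ->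
  continuous (fun x => stab_flux g c o x y).
Proof.
move=> g1 x.
have cdiff : (c * (`|y| `^ g - `|t| `^ g) @[t --> x]
              --> c * (`|y| `^ g - `|x| `^ g))%classic.
  apply: cvgM; first exact: cvg_cst.
  by apply: cvgB; [exact: cvg_cst|exact: continuous_norm_powR].
apply: cvgD; apply: cvgM; [exact: cvg_id| |exact: cvg_cst|].
- apply: cvgB; first exact: cvg_cst.
  exact: (cvg_comp _ _ cdiff (@continuous_neg _)).
- apply: cvgB; first exact: cvg_cst.
  exact: (cvg_comp _ _ cdiff (@continuous_pos _)).
Qed.

End Flux.

(** * Geometry of the periodic grid and solvability of the temperature system *)

Section GridLemmas.
Context {R : realType} {d : nat} {a b : 'I_d -> R}.
Variable G : mac_grid a b.
Implicit Types (K : cell G) (s : face G).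

Lemma step_gt0 i K : 0 < step i K.
Proof. by rewrite subr_gt0 node_lt. Qed.

Lemma cell_meas_gt0 K : 0 < cell_meas K.
Proof. by apply: prodr_gt0 => i _; exact: step_gt0. Qed.

Lemma face_meas_gt0 s : 0 < face_meas s.
Proof. by apply: prodr_gt0 => i _; exact: step_gt0. Qed.

Lemma dual_meas_gt0 s : 0 < dual_meas s.
Proof. by rewrite mulr_gt0 ?invr_gt0 // addr_gt0 ?cell_meas_gt0. Qed.

Lemma dual_density_gt0 (rho : L_M G) s :
  (forall K, 0 < rho K) -> 0 < dual_density rho s.
Proof.
move=> rho0; rewrite divr_gt0 ?dual_meas_gt0 //.
by rewrite addr_gt0 ?mulr_gt0 ?cell_meas_gt0 ?invr_gt0.
Qed.

Lemma ordS_neq n (k : 'I_n) : (1 < n)%N -> ordS k != k.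
Proof.
move=> n1; apply/eqP => /(congr1 val) /=; have kn := ltn_ord k.
have [ksn|kn'] := eqVneq k.+1 n; first by rewrite ksn modnn; lia.
by rewrite modn_small; lia.
Qed.

(** With at least two intervals per direction the cyclic successor has no fixed point, so the tests
    in [across] and [normal] tell the two sides apart. *)
Lemma upper_neq_lower s : upper s != lower s.
Proof.
case: s => i K; apply/eqP => /(congr1 (fun L : cell G => L i)).
rewrite /upper /= /cell_next ffunE dfwith_in => /eqP.
by rewrite (negbTE (ordS_neq _ (ncells_gt1 G i))).
Qed.

Lemma across_lower s : across s (lower s) = upper s.
Proof. by rewrite /across eqxx. Qed.

Lemma across_upper s : across s (upper s) = lower s.
Proof. by rewrite /across (negbTE (upper_neq_lower s)). Qed.

Lemma normal_lower s : normal s (lower s) = 1 :> R.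
Proof. by rewrite /normal eqxx. Qed.

Lemma normal_upper s : normal s (upper s) = -1 :> R.
Proof. by rewrite /normal (negbTE (upper_neq_lower s)). Qed.

(** Once the sums are exchanged, each face is met from exactly two distinct cells, with opposite
    values. *)
Lemma sum_faces_conservative (F : face G -> cell G -> R) :
  (forall s, F s (upper s) = - F s (lower s)) ->
  \sum_K \sum_(s in faces K) F s K = 0.
Proof.
move=> Fopp; rewrite (exchange_big_dep xpredT) //= big1 // => s _.
rewrite (bigD1 (lower s)) ?inE ?eqxx //=.
rewrite (bigD1 (upper s)) ?inE ?eqxx ?orbT ?upper_neq_lower //=.
rewrite big1 ?addr0 ?Fopp ?subrr // => K; rewrite inE => /andP[/andP[]].
by case/orP => /eqP->; rewrite eqxx.
Qed.

(** The change of sign of the normal at the upper cell reverses the difference, so one formula holds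
    on both sides. *)
Lemma outward_dgrad (q : L_M G) s K : s \in faces K ->
  outward (dgrad q) s K = face_meas s / dual_meas s * (q (across s K) - q K).
Proof.
rewrite inE /outward ffunE /= across_lower normal_lower mulr1.
case/orP => /eqP <-.
  by rewrite across_lower normal_lower mulr1.
by rewrite across_upper normal_upper mulrN1 -mulrN opprB.
Qed.

(** The flux depends on density and temperature only through their product, whose nonnegativity
    allows the absolute values of [stab_flux] to be inserted. *)
Lemma temp_fluxE (gamma eta dt eps : R) (rho theta : L_M G) (u : H_E G) s K :
  (forall K, 0 <= rho K * theta K) -> s \in faces K ->
  temp_flux rho theta u (vel_corr eta dt eps (pressure gamma rho theta)) s K =
  face_meas s * stab_flux gamma
    (eta * dt / eps ^+ 2 * (face_meas s / dual_meas s)) (outward u s K)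
    (rho K * theta K) (rho (across s K) * theta (across s K)).
Proof.
move=> w0 sK; rewrite /temp_flux /stab_flux /stab_plus /stab_minus.
set p := pressure _ _ _.
have -> : outward (vel_corr eta dt eps p) s K =
    eta * dt / eps ^+ 2 * (face_meas s / dual_meas s)
    * (`|rho (across s K) * theta (across s K)| `^ gamma
       - `|rho K * theta K| `^ gamma).
  rewrite /outward ffunE -mulrA -[dgrad p s * _]/(outward (dgrad p) s K).
  by rewrite outward_dgrad // !mulrA !ffunE !ger0_norm.
by [].
Qed.

(** Even if every flux were outgoing, less than the mass present in [K] would leave it. *)
Lemma mass_balance_gt0 (dt : R) (rho : L_M G) (u : H_E G) K :
  0 < dt -> 0 < rho K ->
  dt / cell_meas K
    * (\sum_(s in faces K) `|mass_flux rho u s K| / rho K) < 1 ->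
  0 < rho K - dt / cell_meas K * \sum_(s in faces K) mass_flux rho u s K.
Proof.
move=> dt0 r0; have c0 : 0 <= dt / cell_meas K.
  by rewrite ltW ?divr_gt0 ?cell_meas_gt0.
rewrite -mulr_suml mulrA ltr_pdivrMr // mul1r => cfl.
rewrite subr_gt0; apply: le_lt_trans cfl; rewrite ler_wpM2l //.
by apply: ler_sum => s _; exact: ler_norm.
Qed.

Lemma temp_system_solvable (gamma dt : R) (c : face G -> R) (u : H_E G)
    (f : cell G -> R) :
  1 <= gamma -> 0 < dt -> (forall s, 0 <= c s) -> (forall K, 0 < f K) ->
  exists w : cell G -> R, forall K, 0 < w K /\
    w K + dt / cell_meas K * (\sum_(s in faces K) face_meas s
      * stab_flux gamma (c s) (outward u s K) (w K) (w (across s K))) = f K.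
Proof.
move=> g1 dt0 c0 f0.
have k0 K : 0 <= dt / cell_meas K by rewrite ltW ?divr_gt0 ?cell_meas_gt0.
have g0 : 0 <= gamma by exact: le_trans g1.
pose h K x (w : cell G -> R) := x + dt / cell_meas K * (\sum_(s in faces K)
  face_meas s * stab_flux gamma (c s) (outward u s K) x (w (across s K))).
apply: (@perron_solution _ _ (@cell_meas _ _ _ _ G) f h) => //.
- exact: cell_meas_gt0.
- move=> K x w w' x0 ww'; rewrite lerD2l ler_wpM2l // ler_sum // => s _.
  by rewrite ler_wpM2l ?stab_flux_anti // ltW ?face_meas_gt0.
- move=> K w x; apply: cvgD; first exact: cvg_id.
  apply: cvgM; first exact: cvg_cst.
  apply: cvg_big => [|s _]; first exact: add_continuous.
  by apply: cvgM; [exact: cvg_cst|exact: continuous_stab_flux].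
(* Weighting by [cell_meas] cancels the factor [(cell_meas K)^-1], so the fluxes sum to zero and the
   mass bound holds with equality. *)
- move=> w w0; have hE K : cell_meas K * h K (w K) w = cell_meas K * w K
      + dt * \sum_(s in faces K) face_meas s
        * stab_flux gamma (c s) (outward u s K) (w K) (w (across s K)).
    by rewrite /h; field; rewrite gt_eqF ?cell_meas_gt0.
  rewrite (eq_bigr _ (fun K _ => hE K)) big_split /=.
  rewrite -mulr_sumr sum_faces_conservative ?mulr0 ?addr0 //.
  move=> s; rewrite across_lower across_upper /outward normal_lower normal_upper.
  by rewrite mulrN !mulr1 stab_fluxN mulrN.
- move=> K; rewrite /h add0r big1 ?mulr0 // => s _.
  by rewrite stab_flux0 mulr0.
Qed.

End GridLemmas.

(** * Assembly of the new density, temperature and velocity *)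

Theorem theorem3p1 (R : realType) (d : nat) (hd : (1 <= d <= 3)%N)
    (a b : 'I_d -> R) (G : mac_grid a b)
    (gamma eps eta dt : R)
    (hgamma : 1 < gamma) (heps : 0 < eps <= 1) (heta : 0 < eta) (hdt : 0 < dt)
    (rho : L_M G) (u : H_E G) (theta : L_M G)
    (hrho : forall K, 0 < rho K) (htheta : forall K, 0 < theta K)
    (hcfl : forall K : cell G,
       dt / cell_meas K
       * (\sum_(s in faces K) `|mass_flux rho u s K| / rho K) <= 3^-1) :
  exists (rho' : L_M G) (u' : H_E G) (theta' : L_M G),
    [/\ mass_balance dt rho u rho',
        momentum_balance gamma eps dt rho u rho' u' theta',
        temp_balance gamma eps eta dt rho u theta rho' theta',
        forall K, 0 < rho' K
      & forall K, 0 < theta' K].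
Proof.
have dt_neq0 : dt != 0 by rewrite gt_eqF.
pose c (s : face G) := eta * dt / eps ^+ 2 * (face_meas s / dual_meas s).
have c_ge0 s : 0 <= c s.
  case/andP: heps => eps0 _; rewrite ltW // !mulr_gt0 ?invr_gt0 ?exprn_gt0 //.
    exact: face_meas_gt0.
  exact: dual_meas_gt0.
(* The product [w] of the new density and temperature is found first; its system involves only [u]
   and the old product [rho * theta]. *)
have [|w hw] := temp_system_solvable u (f := fun K => rho K * theta K)
  (ltW hgamma) hdt c_ge0; first by move=> K; rewrite mulr_gt0.
pose rho' : L_M G := [ffun K =>
  rho K - dt / cell_meas K * \sum_(s in faces K) mass_flux rho u s K].
have rho'_gt0 K : 0 < rho' K.
  by rewrite ffunE mass_balance_gt0 // (le_lt_trans (hcfl K)) //; lra.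
pose theta' : L_M G := [ffun K => w K / rho' K].
have wE K : rho' K * theta' K = w K.
  by rewrite [theta' K]ffunE mulrC divfK // gt_eqF.
(* With the pressure known, the momentum balance is linear in [u' s] with the positive coefficient
   [dual_density rho' s / dt], and is solved by division. *)
pose u' : H_E G := [ffun s => (dual_density rho s * u s - dt *
  ((dual_meas s)^-1
      * (\sum_(e in dual_faces s) dual_flux rho u e s * upwind rho u e s)
    + (eps ^+ 2)^-1 * dgrad (pressure gamma rho' theta') s))
  / dual_density rho' s].
exists rho', u', theta'; split=> // [K|s|du K|K].
- by rewrite [rho' K]ffunE; field; rewrite dt_neq0 gt_eqF ?cell_meas_gt0.
- have r0 := gt_eqF (dual_density_gt0 s rho'_gt0).
  rewrite [u' s]ffunE [dual_density rho' s * _]mulrC divfK ?r0 //.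
  set X := _ * \sum_(_ in _) _; set Y := _ * dgrad _ _; by field.
- rewrite (eq_bigr (fun s => face_meas s
      * stab_flux gamma (c s) (outward u s K) (w K) (w (across s K)))).
    rewrite wE -(hw K).2; field.
    by rewrite dt_neq0 gt_eqF ?cell_meas_gt0.
  move=> s sK; rewrite temp_fluxE //; first by rewrite !wE.
  by move=> L; rewrite wE ltW //; case: (hw L).
- by rewrite ffunE divr_gt0 //; case: (hw K).
Qed.
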